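(* Let $\mathscr{F}_1$ and $\mathscr{F}_2$ be $\omega$-closed families of nonempty inductive subsets of $\omega$, and let $n_1=\min\bigcup\mathscr{F}_1$ and $n_2=\min\bigcup\mathscr{F}_2$. If the semigroups $\boldsymbol{B}_{\omega}^{\mathscr{F}_1}$ and $\boldsymbol{B}_{\omega}^{\mathscr{F}_2}$ are isomorphic, then any isomorphism $\mathfrak{h}\colon\boldsymbol{B}_{\omega}^{\mathscr{F}_1}\to\boldsymbol{B}_{\omega}^{\mathscr{F}_2}$ is determined by the formula $$\mathfrak{h}(i,j,[n_1+k))=(i,j,[n_2+k)),\qquad i,j\in\omega,$$ for every integer $k$ such that $[n_1+k)\in\mathscr{F}_1$.
   Context: $\omega$ is the set of nonnegative integers, and $[k)=\{i\in\omega\colon i\geqslant k\}$ for $k\in\omega$. A subset $A\subseteq\omega$ is inductive if $i\in A$ implies $i+1\in A$; the nonempty inductive subsets are exactly the sets $[k)$, $k\in\omega$. For an integer $n$ and $F\subseteq\omega$ put $n+F=\{n+k\colon k\in F\}$ (a subset of $\mathbb{Z}$). A nonempty family $\mathscr{F}\subseteq\mathscr{P}(\omega)$ is $\omega$-closed if $F_1\cap(-n+F_2)\in\mathscr{F}$ for all $n\in\omega$ and $F_1,F_2\in\mathscr{F}$. For an $\omega$-closed family $\mathscr{F}$ with $\varnothing\notin\mathscr{F}$, $\boldsymbol{B}_{\omega}^{\mathscr{F}}$ is the set of triples $(i,j,F)$ with $i,j\in\omega$, $F\in\mathscr{F}$, with the (associative) operation $$(i_1,j_1,F_1)\cdot(i_2,j_2,F_2)=\begin{cases}(i_1-j_1+i_2,\,j_2,\,(j_1-i_2+F_1)\cap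 F_2), & j_1<i_2;\\ (i_1,\,j_2,\,F_1\cap F_2), & j_1=i_2;\\ (i_1,\,j_1-i_2+j_2,\,F_1\cap(i_2-j_1+F_2)), & j_1>i_2.\end{cases}$$ *)

(* Defs.v *)
From HB Require Import structures.
From mathcomp Require Import all_boot all_order all_algebra.
From mathcomp Require Import boolp classical_sets.
From mathcomp Require Import zify.
Set Implicit Arguments.
Unset Strict Implicit.
Unset Printing Implicit Defensive.
Import GRing.Theory.
Local Open Scope classical_set_scope.

Definition ray (k : nat) : set nat := [set i | k <= i].

Definition inductive_set (A : set nat) : Prop := forall i, A i -> A i.+1.

Definition translate (n : int) (A : set nat) : set int :=
  [set (n + k%:Z)%R | k in A].

(* Subsets of Z only occur intersected with a subset of omega; the
   intersection is read as a subset of omega. *)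
Definition nat_part (X : set int) : set nat := [set m | X (m%:Z)%R].

Definition omega_closed (F : set (set nat)) : Prop :=
  F !=set0 /\
  forall (n : nat) (A1 A2 : set nat),
    F A1 -> F A2 -> F (A1 `&` nat_part (translate (- n%:Z)%R A2)).

Definition is_min (A : set nat) (n : nat) : Prop :=
  A n /\ forall m, A m -> n <= m.

(* The omega-closed families F without the empty set, i.e. those for which the
   triples below form B_omega^F. *)
Record omegaFamily := OmegaFamily {
  sets_of : set (set nat);
  sets_of_closed : omega_closed sets_of;
  sets_of_set0 : ~ sets_of set0 }.

(* The semigroup B_omega^F; its product is bext_mul below. *)
Record bext (F : omegaFamily) := Triple {
  bext_l : nat;
  bext_r : nat;
  bext_set : set nat;
  bext_mem : sets_of F bext_set }.

HB.instance Definition _ (F : omegaFamily) := gen_eqMixin (bext F).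
HB.instance Definition _ (F : omegaFamily) := gen_choiceMixin (bext F).

(* In the branch j1 < i2 the truncated difference i1 + i2 - j1 is the
   integer i1 - j1 + i2. *)
Definition triple_mul (x y : nat * nat * set nat) : nat * nat * set nat :=
  let: (i1, j1, A1) := x in
  let: (i2, j2, A2) := y in
  if j1 < i2 then
    (i1 + i2 - j1, j2, nat_part (translate (j1%:Z - i2%:Z)%R A1) `&` A2)
  else if j1 == i2 then (i1, j2, A1 `&` A2)
  else (i1, j1 - i2 + j2, A1 `&` nat_part (translate (i2%:Z - j1%:Z)%R A2)).

Definition bext_val (F : omegaFamily) (x : bext F) : nat * nat * set nat :=
  (bext_l x, bext_r x, bext_set x).

Lemma bext_val_inj (F : omegaFamily) : injective (@bext_val F).
Proof.
case=> [i j A FA] [i' j' A' FA'] [] /= ? ? eA; subst.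
by congr Triple; exact: Prop_irrelevance.
Qed.

Lemma triple_mul_mem (F : omegaFamily) (x y : bext F) :
  sets_of F (triple_mul (bext_val x) (bext_val y)).2.
Proof.
case: x y => [i1 j1 A1 F1] [i2 j2 A2 F2]; rewrite /bext_val /=.
have [_ cl] := sets_of_closed F.
case: ltnP => [lt|le].
  have -> : (j1%:Z - i2%:Z = - (i2 - j1)%:Z)%R by lia.
  by rewrite setIC; exact: cl.
case: eqP => [_|ne] /=.
  have := cl 0 _ _ F1 F2; congr (sets_of F (_ `&` _)).
  rewrite eqEsubset; split=> m /=.
    by case=> k Ak /eqP; rewrite oppr0 add0r => /eqP[<-].
  by move=> Am; exists m => //; rewrite oppr0 add0r.
have -> : (i2%:Z - j1%:Z = - (j1 - i2)%:Z)%R by lia.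
exact: cl.
Qed.

Definition bext_mul (F : omegaFamily) (x y : bext F) : bext F :=
  Triple (triple_mul (bext_val x) (bext_val y)).1.1
         (triple_mul (bext_val x) (bext_val y)).1.2
         (triple_mul_mem x y).

Lemma bext_val_mul (F : omegaFamily) (x y : bext F) :
  bext_val (bext_mul x y) = triple_mul (bext_val x) (bext_val y).
Proof.
have pE (p : nat * nat * set nat) : (p.1.1, p.1.2, p.2) = p.
  by case: p => [[]].
exact: pE.
Qed.

Lemma nat_part_translateE (d e : nat) (A : set nat) (m : nat) :
  nat_part (translate (d%:Z - e%:Z)%R A) m <-> d <= m + e /\ A (m + e - d).
Proof.
split=> [[k Ak /= ek]|[le Am]].
  have -> : m + e - d = k by lia.
  by split=> //; lia.
by exists (m + e - d) => //=; lia.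
Qed.

Lemma triple_mulE (i1 j1 i2 j2 : nat) (A1 A2 : set nat) :
  triple_mul (i1, j1, A1) (i2, j2, A2) =
  (i1 + (i2 - j1), j2 + (j1 - i2),
   [set m | A1 (m + (i2 - j1)) /\ A2 (m + (j1 - i2))]).
Proof.
rewrite /triple_mul; case: ltnP => [lt|le].
  congr (_, _, _); [lia|lia|rewrite eqEsubset; split=> m /=].
    case=> /nat_part_translateE[_ A1m] A2m; split.
      by have -> : m + (i2 - j1) = m + i2 - j1 by lia.
    by have -> : m + (j1 - i2) = m by lia.
  case=> A1m A2m; split; last by have <- : m + (j1 - i2) = m by lia.
  apply/nat_part_translateE; split; first lia.
  by have <- : m + (i2 - j1) = m + i2 - j1 by lia.
case: eqP => [->|ne].
  congr (_, _, _); [lia|lia|].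
  by rewrite eqEsubset subnn; split=> m /=; rewrite addn0.
congr (_, _, _); [lia|lia|rewrite eqEsubset; split=> m /=].
  case=> A1m /nat_part_translateE[_ A2m]; split.
    by have -> : m + (i2 - j1) = m by lia.
  by have -> : m + (j1 - i2) = m + j1 - i2 by lia.
case=> A1m A2m; split; first by have <- : m + (i2 - j1) = m by lia.
apply/nat_part_translateE; split; first lia.
by have <- : m + (j1 - i2) = m + j1 - i2 by lia.
Qed.

Lemma triple_mulA : associative triple_mul.
Proof.
move=> [[i1 j1] A1] [[i2 j2] A2] [[i3 j3] A3]; rewrite !triple_mulE.
congr (_, _, _); [lia|lia|].
set a := _ + (i3 - j2) - j1; set b := j1 - (_ + (i3 - j2)).
set c := i3 - (j2 + _); set d := j2 + (j1 - i2) - i3.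
have e1 m : m + a = m + c + (i2 - j1) by lia.
have e2 m : m + b + (i3 - j2) = m + c + (j1 - i2) by lia.
have e3 m : m + b + (j2 - i3) = m + d by lia.
rewrite eqEsubset; split=> m /=; rewrite e1 e2 e3; first by case=> ? [].
by case=> [[]].
Qed.

Lemma bext_mulA (F : omegaFamily) : associative (@bext_mul F).
Proof.
by move=> x y z; apply: bext_val_inj; rewrite !bext_val_mul triple_mulA.
Qed.

HB.instance Definition _ (F : omegaFamily) :=
  isSemigroup.Build (bext F) (@bext_mulA F).

(* Main.v *)
Require Import Defs.
From mathcomp Require Import all_boot all_order all_algebra.
From mathcomp Require Import boolp classical_sets.
From mathcomp Require Import zify.

Set Implicit Arguments.
Unset Strict Implicit.

Local Open Scope classical_set_scope.

(** An isomorphism preserves everything that the multiplication determines;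
    three such pieces of structure suffice to pin it down.

    The triples with a fixed inductive third component A form a bicyclic
    monoid: as in that monoid, [(i, j, A)] is the product of [(i, 0, A)] and
    [(0, j, A)], and its inverse is [(j, i, A)].  Inverses are unique in
    [bext F], so a homomorphism [h] commutes with the exchange of the first two
    coordinates.  This forces [h (i, j, A) = (u i, u j, B)] for a function [u]
    and a set [B] that depend on [A] only ([morph_on_class]).

    The idempotents [(i, i, A)] form a decreasing chain in [i], so [u] is
    strictly increasing when [h] is injective, whence [i <= u i].  The inverse
    isomorphism acts on the class of [B] by some [u'] with the same property
    and [u' (u i) = i]; hence [u] is the identity ([iso_on_class]).

    It remains to follow the third component.  The product of [(0, 0, A)] and
    [(0, 0, C)] is [(0, 0, A `&` C)], so [h] induces an inclusion preserving
    injection from the first family to the second.  The rays of an omega-closed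
    family of rays are those that start in an interval of omega, here with
    minimum [n1].  A strictly increasing map moves the start [n1 + k] to
    [n2 + k] or beyond ([iso_ray_ge]), and the same bound for the inverse
    isomorphism gives equality. *)

(** * Products and inverses of triples *)

Lemma TripleP (F : omegaFamily) (x : bext F) i j A (FA : sets_of F A) :
  bext_val x = (i, j, A) -> x = Triple i j FA.
Proof. by move=> xE; exact: bext_val_inj. Qed.

Lemma val_mulE (F : omegaFamily) (x y : bext F) :
  bext_val (x * y)%g =
  (bext_l x + (bext_l y - bext_r x), bext_r y + (bext_r x - bext_l y),
   [set m | bext_set x (m + (bext_l y - bext_r x)) /\
            bext_set y (m + (bext_r x - bext_l y))]).
Proof. by rewrite [LHS]bext_val_mul triple_mulE. Qed.

(** Comparing the first two coordinates in both equations squeezes those of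
    [y]; then each third component contains the other. *)
Lemma inverse_unique (F : omegaFamily) (x y : bext F) :
  (x * y * x)%g = x -> (y * x * y)%g = y ->
  y = Triple (bext_r x) (bext_l x) (bext_mem x).
Proof.
move=> /(congr1 (@bext_val F)) + /(congr1 (@bext_val F)).
case: x y => [a b A FA] [c d B FB] /=.
rewrite ![bext_val (_ * _)%g]bext_val_mul /bext_val !triple_mulE /= =>
  -[e1 e2 e3] [e4 e5 e6].
have cb : c = b by lia.
have da : d = a by lia.
subst c d.
apply: TripleP => /=; congr (_, _, _).
rewrite eqEsubset; split=> m /=.
  by rewrite -e6 /= !(subnn, addn0); case=> [[]].
by rewrite -e3 /= !(subnn, addn0); case=> [[]].
Qed.

Lemma inductive_addn (A : set nat) (m d : nat) :
  inductive_set A -> A m -> A (m + d).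
Proof.
by move=> indA Am; elim: d => [|d IHd]; rewrite ?addn0 // addnS; exact: indA.
Qed.

(** The product intersects A with one of its backward translates, which contains
    A because A is inductive; so these triples multiply as in the bicyclic
    monoid. *)
Lemma mul_same_set (F : omegaFamily) A (FA : sets_of F A) i j k l :
  inductive_set A ->
  (Triple i j FA * Triple k l FA)%g =
  Triple (i + (k - j)) (l + (j - k)) FA.
Proof.
move=> indA; apply: TripleP; rewrite val_mulE /=; congr (_, _, _).
rewrite eqEsubset; split=> m /=; last first.
  by move=> Am; split; exact: inductive_addn.
(* one of the two truncated differences is 0 *)
case: (leqP k j) => kj [].
  by have -> : m + (k - j) = m by lia.
by move=> _; have -> : m + (j - k) = m by lia.
Qed.

Lemma mul_same_idx (F : omegaFamily) A B (FA : sets_of F A) (FB : sets_of F B) :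
  bext_val (Triple 0 0 FA * Triple 0 0 FB)%g = (0, 0, A `&` B).
Proof.
by rewrite val_mulE /=; congr (_, _, _); rewrite eqEsubset; split=> m /=;
  rewrite addn0.
Qed.

(** * Homomorphisms on the triples with a given third component *)

Lemma morph_flip (F1 F2 : omegaFamily) (h : bext F1 -> bext F2) A
    {FA : sets_of F1 A} {i j} :
  {morph h : x y / (x * y)%g} -> inductive_set A ->
  h (Triple j i FA) =
  Triple (bext_r (h (Triple i j FA))) (bext_l (h (Triple i j FA)))
         (bext_mem (h (Triple i j FA))).
Proof.
move=> hM indA; apply: inverse_unique; rewrite -!hM !mul_same_set //;
  by rewrite !(subnn, addn0).
Qed.

(** Multiplying [(0, j, A)] by its inverse gives [(0, 0, A)], so the image of
    [(0, j, A)] has the first and third components of the image of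
    [(0, 0, A)]; its second component is [u j]. *)
Lemma morph_on_class (F1 F2 : omegaFamily) (h : bext F1 -> bext F2) A
    (FA : sets_of F1 A) :
  {morph h : x y / (x * y)%g} -> inductive_set A ->
  exists (u : nat -> nat) (B : set nat) (FB : sets_of F2 B),
    forall i j, h (Triple i j FA) = Triple (u i) (u j) FB.
Proof.
move=> hM indA.
pose u j := bext_r (h (Triple 0 j FA)).
pose B := bext_set (h (Triple 0 0 FA)).
have FB : sets_of F2 B := bext_mem _.
have idem j : bext_val (h (Triple 0 0 FA)) =
    (bext_l (h (Triple 0 j FA)), bext_l (h (Triple 0 j FA)),
     bext_set (h (Triple 0 j FA))).
  have -> : Triple 0 0 FA = (Triple 0 j FA * Triple j 0 FA)%g.
    by rewrite mul_same_set // subnn.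
  rewrite hM (morph_flip hM indA) val_mulE /= subnn !addn0.
  by congr (_, _, _); rewrite eqEsubset; split=> m /=; rewrite !addn0 //; case.
have row j : h (Triple 0 j FA) = Triple (u 0) (u j) FB.
  apply: TripleP; have := idem j; rewrite /bext_val => -[e1 e2 e3].
  by rewrite /u /B -e3 -e2.
exists u, B, FB => i j.
have -> : Triple i j FA = (Triple i 0 FA * Triple 0 j FA)%g.
  by rewrite mul_same_set // subnn !addn0.
rewrite hM (morph_flip hM indA) !row /=.
apply: TripleP; rewrite val_mulE /= subnn !addn0; congr (_, _, _).
by rewrite eqEsubset; split=> m /=; rewrite !addn0 //; case.
Qed.

(** The product of the idempotents with indices [i] and [i.+1] is the latter,
    which makes [u] nondecreasing; injectivity makes it strictly so. *)
Lemma class_index_ge (F1 F2 : omegaFamily) (h : bext F1 -> bext F2) A B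
    (FA : sets_of F1 A) (FB : sets_of F2 B) (u : nat -> nat) :
  {morph h : x y / (x * y)%g} -> injective h -> inductive_set A ->
  (forall i j, h (Triple i j FA) = Triple (u i) (u j) FB) ->
  forall i, i <= u i.
Proof.
move=> hM hI indA hE; elim=> // i IHi.
apply: (leq_ltn_trans IHi); rewrite ltn_neqAle; apply/andP; split.
  apply/eqP => uE; have : h (Triple i i FA) = h (Triple i.+1 i.+1 FA).
    by rewrite !hE uE.
  by move/hI/(congr1 (@bext_l F1)) => /=; lia.
have := hM (Triple i i FA) (Triple i.+1 i.+1 FA).
rewrite mul_same_set // !hE => /(congr1 (@bext_val F2)).
have -> : i + (i.+1 - i) = i.+1 by lia.
by rewrite val_mulE /= => -[e _ _]; lia.
Qed.

Lemma can_morph (F1 F2 : omegaFamily) (h : bext F1 -> bext F2) g :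
  {morph h : x y / (x * y)%g} -> cancel h g -> cancel g h ->
  {morph g : x y / (x * y)%g}.
Proof. by move=> hM hK gK x y; rewrite -{1}[x]gK -{1}[y]gK -hM hK. Qed.

Lemma iso_on_class (F1 F2 : omegaFamily) (h : bext F1 -> bext F2) g A
    (FA : sets_of F1 A) :
  {morph h : x y / (x * y)%g} -> cancel h g -> cancel g h ->
  (forall A, sets_of F1 A -> inductive_set A) ->
  (forall A, sets_of F2 A -> inductive_set A) ->
  exists (B : set nat) (FB : sets_of F2 B),
    forall i j, h (Triple i j FA) = Triple i j FB.
Proof.
move=> hM hK gK ind1 ind2.
have gM := can_morph hM hK gK.
have [u [B [FB hE]]] := morph_on_class FA hM (ind1 _ FA).
have [u' [C [FC gE]]] := morph_on_class FB gM (ind2 _ FB).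
have uge := class_index_ge hM (can_inj hK) (ind1 _ FA) hE.
have u'ge := class_index_ge gM (can_inj gK) (ind2 _ FB) gE.
have uE i : u i = i.
  have := hK (Triple i i FA); rewrite hE gE => /(congr1 (@bext_l F1)) /= e.
  by apply/eqP; rewrite eqn_leq uge andbT -{2}e; exact: u'ge.
by exists B, FB => i j; rewrite hE !uE.
Qed.

(** * Isomorphisms and families of rays *)

Lemma ray_subset a b : ray a `<=` ray b <-> b <= a.
Proof.
split=> [|ba m /=]; last exact: leq_trans.
by apply; exact: leqnn.
Qed.

Lemma ray_inj a b : ray a = ray b -> a = b.
Proof.
move=> e; apply/eqP; rewrite eqn_leq.
by apply/andP; split; apply/ray_subset; rewrite e.
Qed.

Lemma inductive_ray (A : set nat) :
  A !=set0 -> inductive_set A -> exists m, A = ray m.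
Proof.
move=> [a0 Aa0] indA.
have exA : exists n, `[< A n >] by exists a0; apply/asboolP.
case: (ex_minnP exA) => m /asboolP Am minm.
exists m; rewrite eqEsubset; split=> i.
  by move=> Ai; apply: minm; apply/asboolP.
by move=> mi; rewrite -(subnKC mi); exact: inductive_addn.
Qed.

Lemma min_le_ray (F : omegaFamily) n m :
  is_min (\bigcup_(A in sets_of F) A) n -> sets_of F (ray m) -> n <= m.
Proof. by move=> [_ nmin] Fm; apply: nmin; exists (ray m) => //; exact: leqnn. Qed.

Lemma min_ray_mem (F : omegaFamily) n :
  (forall A, sets_of F A -> A !=set0 /\ inductive_set A) ->
  is_min (\bigcup_(A in sets_of F) A) n -> sets_of F (ray n).
Proof.
move=> indF nmin; have [[A FA An] _] := nmin.
have [A0 indA] := indF _ FA; have [m mE] := inductive_ray A0 indA.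
rewrite {}mE in FA An; have := min_le_ray nmin FA => nm.
by have -> : n = m by apply/eqP; rewrite eqn_leq nm.
Qed.

Lemma ray_pred_mem (F : omegaFamily) n k :
  sets_of F (ray n) -> sets_of F (ray (n + k.+1)) -> sets_of F (ray (n + k)).
Proof.
move=> Fn Fk; have [_ cl] := sets_of_closed F.
(* shifting the smaller ray by -1 yields the ray from n + k, which the larger
   ray contains *)
have := cl 1 _ _ Fn Fk; congr (sets_of F _).
have -> : (- 1%:Z = 0%:Z - 1%:Z)%R by lia.
rewrite /ray eqEsubset; split=> m /=.
  by case=> nm /nat_part_translateE[_] /=; lia.
move=> km; split; first by lia.
by apply/nat_part_translateE; split=> //=; lia.
Qed.

(** By induction along the rays from [n1], [n1 + 1], and so on: inclusion is
    preserved since it says that a product of idempotents is one of its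
    factors, and it stays proper by injectivity, so each step moves the start of
    the image by at least one. *)
Lemma iso_ray_ge (F1 F2 : omegaFamily) (n1 n2 : nat) (h : bext F1 -> bext F2) g :
  (forall A, sets_of F1 A -> A !=set0 /\ inductive_set A) ->
  (forall A, sets_of F2 A -> A !=set0 /\ inductive_set A) ->
  is_min (\bigcup_(A in sets_of F1) A) n1 ->
  is_min (\bigcup_(A in sets_of F2) A) n2 ->
  {morph h : x y / (x * y)%g} -> cancel h g -> cancel g h ->
  forall k p (Fk : sets_of F1 (ray (n1 + k))) (Fp : sets_of F2 (ray p)),
    h (Triple 0 0 Fk) = Triple 0 0 Fp -> n2 + k <= p.
Proof.
move=> ind1 ind2 min1 min2 hM hK gK; elim=> [|k IHk] p Fk Fp hE.
  by rewrite addn0; exact: min_le_ray min2 Fp.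
have Fk' := ray_pred_mem (min_ray_mem ind1 min1) Fk.
have [B [FB hE']] := iso_on_class Fk' hM hK gK
  (fun A FA => (ind1 A FA).2) (fun A FA => (ind2 A FA).2).
have [q qE] := inductive_ray (ind2 _ FB).1 (ind2 _ FB).2; subst B.
have kq := IHk _ _ _ (hE' 0 0).
rewrite addnS; apply: (leq_ltn_trans kq); rewrite ltn_neqAle; apply/andP; split.
  apply/eqP => qp.
  have : h (Triple 0 0 Fk') = h (Triple 0 0 Fk).
    by rewrite hE hE'; apply: TripleP; rewrite /bext_val /= qp.
  by move/(can_inj hK)/(congr1 (@bext_set F1))/ray_inj; lia.
apply/ray_subset.
have absorb : (Triple 0 0 Fk * Triple 0 0 Fk')%g = Triple 0 0 Fk.
  apply: TripleP; rewrite mul_same_idx; congr (_, _, _).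
  by apply: setIidl; apply/ray_subset; lia.
have := hM (Triple 0 0 Fk) (Triple 0 0 Fk').
rewrite absorb hE hE' => /(congr1 (@bext_val F2)); rewrite mul_same_idx.
by move=> [->] m [].
Qed.

Theorem mainTheorem4 (F1 F2 : omegaFamily) (n1 n2 : nat)
  (F1_inductive : forall A : set nat, sets_of F1 A -> A !=set0 /\ inductive_set A)
  (F2_inductive : forall A : set nat, sets_of F2 A -> A !=set0 /\ inductive_set A)
  (n1_min : is_min (\bigcup_(A in sets_of F1) A) n1)
  (n2_min : is_min (\bigcup_(A in sets_of F2) A) n2)
  (h : {multiplicative bext F1 -> bext F2}) (h_bij : bijective h)
  (k : int) (m1 : nat) (m1E : Posz m1 = (n1%:Z + k)%R)
  (F1m1 : sets_of F1 (ray m1)) :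
  exists (m2 : nat) (F2m2 : sets_of F2 (ray m2)),
    Posz m2 = (n2%:Z + k)%R /\
    forall i j : nat, h (Triple i j F1m1) = Triple i j F2m2.
Proof.
have [g hK gK] := h_bij.
have hM : {morph h : x y / (x * y)%g} by exact: gmulfM.
have [B [FB hE]] := iso_on_class F1m1 hM hK gK
  (fun A FA => (F1_inductive A FA).2) (fun A FA => (F2_inductive A FA).2).
have [p pE] := inductive_ray (F2_inductive _ FB).1 (F2_inductive _ FB).2.
subst B; exists p, FB; split=> //.
have gE : g (Triple 0 0 FB) = Triple 0 0 F1m1 by rewrite -hE hK.
have [d dE] : exists d, m1 = n1 + d.
  by exists (m1 - n1); rewrite subnKC //; exact: min_le_ray n1_min F1m1.
have [e eE] : exists e, p = n2 + e.
  by exists (p - n2); rewrite subnKC //; exact: min_le_ray n2_min FB.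
subst m1 p.
have de := iso_ray_ge F1_inductive F2_inductive n1_min n2_min hM hK gK (hE 0 0).
have ed := iso_ray_ge F2_inductive F1_inductive n2_min n1_min
  (can_morph hM hK gK) gK hK gE.
by lia.
Qed.
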